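(* Let $G$ be a graph on $\{1,\dots,n\}$ and let $\mathbf c$ be a relative interior regular point of a fixed hull and contact class $X=\mathcal F\cap\mathcal C(G)$. If $\mathcal R_{\mathbf c}=\{0\}$, then $\mathbf c$ has no nontrivial first order admissible motion in $X$ after quotienting by rigid motions. Equivalently, $\mathbf{Roll}(\mathbf c)=R(\mathbf c)$.
   Context: $\mathcal D_n=\{\mathbf c\in(\mathbb R^2)^n:\|\mathbf c_i-\mathbf c_j\|\ge2\ \forall i\ne j\}$; $P(\mathbf c)=\operatorname{conv}\{\mathbf c_1,\dots,\mathbf c_n\}$. For a graph $G$ on $\{1,\dots,n\}$ with edge set $E(G)$: $\mathcal C(G)$ is the set of $\mathbf c\in\mathcal D_n$ with $\|\mathbf c_i-\mathbf c_j\|=2$ exactly for $\{i,j\}\in E(G)$ (and $>2$ for non-edges); $M(G)=\{\mathbf d\in(\mathbb R^2)^n:\|\mathbf d_i-\mathbf d_j\|=2\ \forall\{i,j\}\in E(G)\}$; $\mathbf d\in M(G)$ is regular for $G$ if the gradients at $\mathbf d$ of $g_{ij}(\mathbf d)=\|\mathbf d_j-\mathbf d_i\|^2-4$, $\{i,j\}\in E(G)$, are linearly independent. $\mathbf c$ is hull stable if all configurations of $\mathcal D_n$ in some neighbourhood of $\mathbf c$ have a centre hull with the same set of hull vertex indices and the same cyclic order as $P(\mathbf c)$. For hull stable $\mathbf c\in\mathcal C(G)$ regular for $G$, let $\mathcal F$ be the set of configurations whose centre hull has the same hull vertex set and cyclic order as $P(\mathbf c)$. A fixed hull and contact class is a set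 $X=\mathcal F\cap\mathcal C(G)$ of this form. A point $\mathbf c\in X$ is a relative interior regular point if it is regular for $G$ and there is an open neighbourhood $U_0$ of $\mathbf c$ in $(\mathbb R^2)^n$ with $\|\mathbf d_i-\mathbf d_j\|>2$ for all $\mathbf d\in U_0\cap M(G)$ and all $\{i,j\}\notin E(G)$, and $U_0\cap\mathcal D_n\subset\mathcal F$ (so that $X\cap U_0=M(G)\cap U_0$ and $T_{\mathbf c}X=\mathbf{Roll}(\mathbf c)$). For $\{i,j\}\in E(G)$, $\mathbf u_{ij}=(\mathbf c_j-\mathbf c_i)/\|\mathbf c_j-\mathbf c_i\|$. The rolling space is $\mathbf{Roll}(\mathbf c)=\{\delta\mathbf c\in(\mathbb R^2)^n:\langle\mathbf u_{ij},\delta\mathbf c_j-\delta\mathbf c_i\rangle=0\ \forall\{i,j\}\in E(G)\}$; its elements are the first order admissible motions in $X$. $R(\mathbf c)=\{(\mathbf a+\omega J\mathbf c_1,\dots,\mathbf a+\omega J\mathbf c_n):\mathbf a\in\mathbb R^2,\omega\in\mathbb R\}$ with $J(x,y)=(-y,x)$ is the infinitesimal rigid motion space, and $\mathcal R_{\mathbf c}=\mathbf{Roll}(\mathbf c)\cap R(\mathbf c)^\perp$ (standard inner product). *)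

(* Defs.v *)
From HB Require Import structures.
From mathcomp Require Import all_boot all_order all_algebra.
From mathcomp Require Import all_classical all_reals all_analysis.
Set Implicit Arguments.
Unset Strict Implicit.
Unset Printing Implicit Defensive.
Import Order.TTheory GRing.Theory Num.Theory.
Import numFieldNormedType.Exports.
Local Open Scope classical_set_scope.
Local Open Scope ring_scope.

(* A configuration of n points of the plane is an n x 2 matrix whose i-th row
   is the i-th centre; its topology is the product topology of (R^2)^n. The
   library norm on matrices is the sup norm, hence [enorm] below. *)
Notation plane R := 'rV[R]_2.
Notation config R n := 'M[R]_(n, 2).

Definition dot (R : realType) (u v : plane R) : R :=
  \sum_(k < 2) u 0 k * v 0 k.

Definition enorm (R : realType) (u : plane R) : R := Num.sqrt (dot u u).

Definition config_dot (R : realType) (n : nat) (c d : config R n) : R :=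
  \sum_(i < n) dot (row i c) (row i d).

Definition centre_dist (R : realType) (n : nat) (c : config R n) (i j : 'I_n) : R :=
  enorm (row i c - row j c).

Definition disk_configs (R : realType) (n : nat) : set (config R n) :=
  [set c | forall i j : 'I_n, i != j -> 2 <= centre_dist c i j].

(** Contact graphs; graphs are symmetric irreflexive relations [G] on 'I_n. *)

Definition contact_stratum (R : realType) (n : nat) (G : rel 'I_n) :
    set (config R n) :=
  [set c | disk_configs c /\
    forall i j : 'I_n, i != j ->
      if G i j then centre_dist c i j = 2 else 2 < centre_dist c i j].

Definition contact_manifold (R : realType) (n : nat) (G : rel 'I_n) :
    set (config R n) :=
  [set d | forall i j : 'I_n, G i j -> centre_dist d i j = 2].

Definition contact_fun (R : realType) (n : nat) (i j : 'I_n)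
    (d : config R n) : R :=
  enorm (row j d - row i d) ^+ 2 - 4.

Definition gradient (R : realType) (n : nat) (g : config R n -> R)
    (d : config R n) : config R n :=
  \matrix_(i < n, k < 2) 'D_(delta_mx i k) g d.

(* Each edge {i, j} is listed once, as the pair with i < j. *)
Definition edges (n : nat) (G : rel 'I_n) : seq ('I_n * 'I_n) :=
  enum [pred p : 'I_n * 'I_n | (p.1 < p.2)%N && G p.1 p.2].

Definition regular_point (R : realType) (n : nat) (G : rel 'I_n) (d : config R n) :
    Prop :=
  contact_manifold G d /\
  free [seq gradient (contact_fun p.1 p.2) d | p <- edges G].

Definition centre_hull (R : realType) (n : nat) (c : config R n) :
    set (plane R) :=
  smallest (@convex_set R (plane R)) [set row i c | i in [set: 'I_n]].

Definition extreme_point (R : realType) (A : set (plane R)) (x : plane R) :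
    Prop :=
  A x /\
  forall (y z : plane R) (t : R), A y -> A z -> 0 < t < 1 ->
    x = t *: y + (1 - t) *: z -> y = x /\ z = x.

Definition hull_vertices (R : realType) (n : nat) (c : config R n) :
    set 'I_n :=
  [set i | extreme_point (centre_hull c) (row i c)].

(* Twice the signed area of the triangle x y z. *)
Definition orient (R : realType) (x y z : plane R) : R :=
  (y - x) 0 0 * (z - x) 0 1 - (y - x) 0 1 * (z - x) 0 0.

Definition hull_edge (R : realType) (n : nat) (c : config R n) : rel 'I_n :=
  fun i j => [forall k, 0 <= orient (row i c) (row j c) (row k c)].

(* [s] lists the hull vertices once each, in counterclockwise order along the
   boundary: every centre lies weakly to the left of the line through two
   cyclically consecutive vertices. [s] is determined up to rotation. *)
Definition hull_cycle (R : realType) (n : nat) (c : config R n)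
    (s : seq 'I_n) : Prop :=
  [/\ uniq s, [set` s] = hull_vertices c & cycle (hull_edge c) s].

Definition same_hull (R : realType) (n : nat) (c d : config R n) : Prop :=
  hull_vertices c = hull_vertices d /\
  forall s : seq 'I_n, hull_cycle c s <-> hull_cycle d s.

Definition hull_stable (R : realType) (n : nat) (c : config R n) : Prop :=
  \forall d \near c, disk_configs d -> same_hull c d.

Definition hull_class (R : realType) (n : nat) (c : config R n) :
    set (config R n) :=
  [set d | disk_configs d /\ same_hull c d].

Definition fixed_hull_contact_class (R : realType) (n : nat) (G : rel 'I_n)
    (F X : set (config R n)) : Prop :=
  exists c0 : config R n,
    [/\ contact_stratum G c0, hull_stable c0, regular_point G c0,
        F = hull_class c0 & X = F `&` contact_stratum G].

Definition relative_interior_regular (R : realType) (n : nat) (G : rel 'I_n)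
    (F X : set (config R n)) (c : config R n) : Prop :=
  [/\ X c, regular_point G c &
    exists U0 : set (config R n),
      [/\ open U0, U0 c,
        (forall d, (U0 `&` contact_manifold G) d ->
          forall i j : 'I_n, i != j -> ~~ G i j -> 2 < centre_dist d i j) &
        U0 `&` @disk_configs R n `<=` F]].

Definition contact_dir (R : realType) (n : nat) (c : config R n)
    (i j : 'I_n) : plane R :=
  (enorm (row j c - row i c))^-1 *: (row j c - row i c).

(* At a relative interior regular point of a fixed hull and contact class X,
   these are the first order admissible motions in X. *)
Definition Roll (R : realType) (n : nat) (G : rel 'I_n) (c : config R n) :
    set (config R n) :=
  [set dc | forall i j : 'I_n, G i j ->
    dot (contact_dir c i j) (row j dc - row i dc) = 0].

Definition rot90 (R : realType) (u : plane R) : plane R :=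
  \row_(k < 2) (if k == 0 then - u 0 1 else u 0 0).

Definition rigid_motions (R : realType) (n : nat) (c : config R n) :
    set (config R n) :=
  [set dc | exists (a : plane R) (w : R),
    dc = \matrix_(i < n) (a + w *: rot90 (row i c))].

Definition orthogonal_compl (R : realType) (n : nat) (A : set (config R n)) :
    set (config R n) :=
  [set d | forall e, A e -> config_dot d e = 0].

Definition reduced_roll (R : realType) (n : nat) (G : rel 'I_n)
    (c : config R n) : set (config R n) :=
  Roll G c `&` orthogonal_compl (rigid_motions c).

Definition rigid_equiv (R : realType) (n : nat) (c d d' : config R n) : Prop :=
  rigid_motions c (d - d').

(* Main.v *)
(* The plain inner product on configurations is positive definite, so every
   configuration splits as a rigid motion plus a vector orthogonal to all rigid
   motions. Rigid motions roll, hence the orthogonal part of a rolling motion is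
   again rolling; it lies in the reduced rolling space and vanishes. *)
Require Import Defs.
From mathcomp Require Import all_boot all_order all_algebra.
From mathcomp Require Import all_classical all_reals all_analysis.
From mathcomp Require Import ring.
Set Implicit Arguments.
Unset Strict Implicit.
Unset Printing Implicit Defensive.
Import Order.TTheory GRing.Theory Num.Theory.
Local Open Scope classical_set_scope.
Local Open Scope ring_scope.

Lemma dotDr (R : realType) (x u v : plane R) :
  dot x (u + v) = dot x u + dot x v.
Proof. by rewrite /dot -big_split; apply: eq_bigr => k _; rewrite mxE mulrDr. Qed.

Lemma dotZr (R : realType) (a : R) (u v : plane R) :
  dot u (a *: v) = a * dot u v.
Proof. by rewrite /dot mulr_sumr; apply: eq_bigr => k _; rewrite mxE mulrCA. Qed.

Lemma dotC (R : realType) (u v : plane R) : dot u v = dot v u.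
Proof. by apply: eq_bigr => k _; rewrite mulrC. Qed.

Lemma dot_rot90 (R : realType) (u : plane R) : dot u (rot90 u) = 0.
Proof.
rewrite /dot !big_ord_recl big_ord0 !mxE /=.
by rewrite (_ : lift ord0 ord0 = 1 :> 'I_2); [ring|exact: val_inj].
Qed.

Lemma rot90B (R : realType) (u v : plane R) : rot90 (u - v) = rot90 u - rot90 v.
Proof. by apply/rowP => k; rewrite !mxE; case: ifP => _; ring. Qed.

Section ConfigDot.
Context {R : realType} {n : nat}.
Implicit Types (c d e : config R n) (U : {vspace (config R n)}).

Lemma config_dotC c d : config_dot c d = config_dot d c.
Proof. by apply: eq_bigr => i _; rewrite dotC. Qed.

Lemma config_dotDr c d e : config_dot c (d + e) = config_dot c d + config_dot c e.
Proof. by rewrite /config_dot -big_split; apply: eq_bigr => i _; rewrite linearD dotDr. Qed.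

Lemma config_dotZr (a : R) c d : config_dot c (a *: d) = a * config_dot c d.
Proof. by rewrite /config_dot mulr_sumr; apply: eq_bigr => i _; rewrite linearZ dotZr. Qed.

Lemma config_dotBl c d e : config_dot (c - d) e = config_dot c e - config_dot d e.
Proof.
by rewrite config_dotC config_dotDr -scaleN1r config_dotZr mulN1r !(config_dotC e).
Qed.

(** A vanishing sum of nonnegative terms vanishes term by term; this is used once over the rows and
    once over the two coordinates. Such definiteness settles the degenerate step in the projection
    below. *)
Lemma config_dot_eq0 c : config_dot c c = 0 -> c = 0.
Proof.
have dot_ge0 (u : plane R) : 0 <= dot u u.
  by apply: sumr_ge0 => k _; rewrite -expr2 sqr_ge0.
move/eqP; rewrite psumr_eq0 => [/allP c0|i _]; last exact: dot_ge0.
apply/matrixP => i k; have := c0 i (mem_index_enum i).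
rewrite psumr_eq0 => [/allP /(_ k (mem_index_enum k))|j _]; last first.
  by rewrite -expr2 sqr_ge0.
by rewrite /= -expr2 sqrf_eq0 !mxE => /eqP.
Qed.

(** Induction on a list of vectors spanning [U], with [d] left general: the induction hypothesis
    then projects both [d] and the new vector [v] onto the span of the remaining ones. *)
Lemma orthogonal_projection U d :
  exists2 p, p \in U & forall u, u \in U -> config_dot (d - p) u = 0.
Proof.
rewrite -(span_basis (vbasisP U)); elim: (tval (vbasis U)) d => [|v s IH] d.
  exists 0; first by rewrite mem0v.
  move=> u; rewrite span_nil memv0 => /eqP ->.
  by rewrite -(scale0r 0) config_dotZr mul0r.
have [p ps dp] := IH d; have [q qs vq] := IH v.
(* Gram-Schmidt step; when w = 0, division by zero gives t = 0, as needed. *)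
pose w := v - q; pose t := config_dot (d - p) w / config_dot w w.
have tw : config_dot (d - p) w = t * config_dot w w.
  have [ww0|ww0] := eqVneq (config_dot w w) 0; last by rewrite divfK.
  by rewrite ww0 mulr0 (config_dot_eq0 ww0) -(scale0r 0) config_dotZr mul0r.
have sub_s u : u \in << s >>%VS -> u \in <<v :: s>>%VS.
  by apply/subvP: u; rewrite span_cons addvSr.
exists (p + t *: w).
  by rewrite memvD ?memvZ ?memvB ?(sub_s p) ?(sub_s q) // memv_span ?mem_head.
move=> u; rewrite span_cons => /memv_addP[_ /vlineP[a ->] [z zs ->]].
(* Trading [v] for [w + q] moves [q] into the part lying in the span of [s], so it suffices to test
   against [w] and against that span. *)
have -> : a *: v + z = a *: w + (a *: q + z).
  by rewrite /w scalerBr addrA subrK.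
have rs : a *: q + z \in << s >>%VS by rewrite memvD ?memvZ.
set r := a *: q + z in rs *.
(* Against [r] both [d - p] and [w] give zero; against [w] the two contributions cancel by the
   choice of [t]. *)
rewrite opprD addrA config_dotBl config_dotDr config_dotZr (dp r) // tw.
rewrite (config_dotC (t *: w)) config_dotZr (config_dotC (a *: w + r)).
rewrite [config_dot (_ + _) w]config_dotC (config_dotDr w (a *: w)).
by rewrite config_dotZr [config_dot w r](vq r) //; ring.
Qed.

End ConfigDot.

(** The generators are the two unit translations and the rotation about the origin. They can be
    dependent, for instance when [n = 1], so they are a spanning family rather than a basis. *)
Definition rigid_space (R : realType) (n : nat) (c : config R n) :
    {vspace (config R n)} :=
  span [:: \matrix_(i < n) delta_mx 0 0; \matrix_(i < n) delta_mx 0 1;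
           \matrix_(i < n) rot90 (row i c)].

Lemma rigid_motionsE (R : realType) (n : nat) (c d : config R n) :
  rigid_motions c d <-> d \in rigid_space c.
Proof.
rewrite /rigid_space !span_cons span_nil addv0; split.
  move=> [a [w ->]].
  have -> : \matrix_(i < n) (a + w *: rot90 (row i c)) =
      a 0 0 *: \matrix_(i < n) delta_mx 0 0 +
      (a 0 1 *: \matrix_(i < n) delta_mx 0 1 +
       w *: \matrix_(i < n) rot90 (row i c)).
    (* The rotation terms agree in each row; what remains is the expansion of [a] in the standard
       basis of the plane. *)
    apply/row_matrixP => i; rewrite !(linearD, linearZ) /= !rowK addrA.
    congr (_ + _); rewrite [LHS]row_sum_delta !big_ord_recl big_ord0 addr0.
    by rewrite (_ : lift ord0 ord0 = 1 :> 'I_2) //; apply: val_inj.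
  by rewrite !memv_add ?memvZ ?memv_line.
move=> /memv_addP[_ /vlineP[x ->]] [_ /memv_addP[_ /vlineP[y ->]] [_ /vlineP[w ->]] ->] ->.
exists (x *: delta_mx 0 0 + y *: delta_mx 0 1), w.
by apply/row_matrixP => i; rewrite !(linearD, linearZ) /= !rowK addrA.
Qed.

(** Translations cancel in the difference of two rows, and the rotation contributes a multiple of
    the quarter turn of [row j c - row i c], which is orthogonal to the contact direction. *)
Lemma rigid_motions_Roll (R : realType) (n : nat) (G : rel 'I_n)
  (c : config R n) : rigid_motions c `<=` Roll G c.
Proof.
move=> _ [a [w ->]] i j _; rewrite !rowK.
rewrite opprD addrACA subrr add0r -scalerBr -rot90B dotZr dotC dotZr dotC.
by rewrite dot_rot90 !mulr0.
Qed.

Lemma RollB (R : realType) (n : nat) (G : rel 'I_n) (c d e : config R n) :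
  Roll G c d -> Roll G c e -> Roll G c (d - e).
Proof.
move=> dR eR i j Gij; have -> : row j (d - e) - row i (d - e) =
    (row j d - row i d) + -1 *: (row j e - row i e).
  by apply/rowP => k; rewrite !mxE; ring.
by rewrite dotDr dotZr dR ?eR ?mulr0 ?addr0.
Qed.

Theorem proposition5p8 (R : realType) (n : nat) (G : rel 'I_n)
    (G_sym : symmetric G) (G_irr : irreflexive G)
    (F X : set (config R n)) (c : config R n)
    (hX : fixed_hull_contact_class G F X)
    (hc : relative_interior_regular G F X c)
    (hR : reduced_roll G c = [set 0]) :
  (~ exists dc : config R n, Roll G c dc /\ ~ rigid_equiv c dc 0) /\
  Roll G c = rigid_motions c.
Proof.
have RollE : Roll G c = rigid_motions c.
  apply/seteqP; split=> [d dR|]; last exact: rigid_motions_Roll.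
  have [p /rigid_motionsE pr dp] := orthogonal_projection (rigid_space c) d.
  suff : reduced_roll G c (d - p).
    by rewrite hR => /eqP; rewrite subr_eq0 => /eqP ->.
  split; first by apply: RollB => //; apply: rigid_motions_Roll.
  by move=> e /rigid_motionsE/dp.
(* Being equivalent to [0] modulo rigid motions is the same as being a rigid motion, so the equality
   of spaces excludes a nontrivial rolling motion. *)
by split=> // -[d []]; rewrite RollE /rigid_equiv subr0.
Qed.
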